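(* Let $T$ be a finite tree with edge set $F$, let $\delta\ge 0$ be an integer, and let $\mathcal{P}$ be a finite multiset of paths in $T$ such that every edge of $T$ lies in at least $\delta$ paths of $\mathcal{P}$. Consider the hypergraph $H$ with vertex set $F$ and one hyperedge $E(P)\subseteq F$ (the set of edges of $P$) for each $P\in\mathcal{P}$. Then $\mathsf{p}'(H)\ge 1+\lfloor(\delta-1)/5\rfloor$; that is, $\mathcal{P}$ can be partitioned into $1+\lfloor(\delta-1)/5\rfloor$ subfamilies, each of which covers every edge of $T$.
   Context: For a hypergraph $H=(V,\mathcal{E})$ ($V$ finite, $\mathcal{E}$ a finite multiset of subsets of $V$), a set cover is a subfamily of $\mathcal{E}$ whose union is $V$, and $\mathsf{p}'(H)$ is the maximum $k$ such that $\mathcal{E}$ can be partitioned into $k$ set covers. *)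

(* Defs.v *)
From HB Require Import structures.
From mathcomp Require Import all_boot all_order all_algebra.
From mathcomp Require Import constructive_ereal.

Set Implicit Arguments.
Unset Strict Implicit.
Unset Printing Implicit Defensive.

Import Order.TTheory GRing.Theory Num.Theory.

(* The multiset of hyperedges is a family indexed by a finite type, so repeated
   hyperedges are allowed and counted with multiplicity. *)
Record hypergraph := Hypergraph {
  hpoint : finType;
  hverts : {set hpoint};
  hindex : finType;
  hedge : hindex -> {set hpoint};
  hedge_sub : forall i, hedge i \subset hverts
}.

Definition set_cover (H : hypergraph) (C : {set hindex H}) : bool :=
  \bigcup_(i in C) hedge i == hverts H.

(* A partition into k subfamilies is given by the map sending each hyperedge to
   its part. Parts may be empty, which matters only if H has no vertex: the
   empty subfamily is then a set cover. *)
Definition cover_decomposable (H : hypergraph) (k : nat) : bool :=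
  [exists c : {ffun hindex H -> 'I_k},
    [forall j, set_cover [set i | c i == j]]].

(* The number p'(H). If H has no vertex, every k > 0 is admissible and the value
   is +oo. Otherwise k <= #|hindex H| for every admissible k, so the bound on the
   range of the maximum is harmless; the value is 0 when no k is admissible. See
   [cover_decomposable0V] and [cover_decomposable_leq]. *)
Definition cover_decomposition_number (H : hypergraph) : \bar int :=
  if hverts H == set0 then +oo%E
  else ((\max_(k < #|hindex H|.+1 | cover_decomposable H k) k)%N%:Z)%:E.

Lemma cover_decomposable0V (H : hypergraph) (k : nat) :
  hverts H = set0 -> (0 < k)%N -> cover_decomposable H k.
Proof.
move=> V0; case: k => // k _; apply/existsP; exists [ffun=> ord0].
apply/forallP => j; rewrite /set_cover V0 -subset0.
by apply/bigcupsP => i _; rewrite -V0 hedge_sub.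
Qed.

Lemma cover_decomposable_leq (H : hypergraph) (k : nat) :
  hverts H != set0 -> cover_decomposable H k -> (k <= #|hindex H|)%N.
Proof.
case/set0Pn => v vV /existsP[c /forallP cP].
have sur j : exists i, c i == j.
  have /eqP E := cP j; move: vV; rewrite -E.
  by case/bigcupP => i; rewrite inE => cij _; exists i.
pose g j := xchoose (sur j).
have gK : cancel g c by move=> j; apply/eqP/(xchooseP (sur j)).
by rewrite -[k in (k <= _)%N]card_ord; apply: leq_card (can_inj gK).
Qed.

Record sgraph := SGraph {
  svertex :> finType;
  sadj : rel svertex;
  sadj_sym : symmetric sadj;
  sadj_irr : irreflexive sadj
}.

Definition edge_set (G : sgraph) : {set {set G}} :=
  [set [set q.1; q.2] | q : G * G & sadj q.1 q.2].

(* [cycle] regards [:: x; y] with x, y adjacent as a closed walk, so genuine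
   cycles are those with at least three vertices. *)
Definition is_tree (G : sgraph) : Prop :=
  [/\ (0 < #|G|)%N,
      forall x y : G, connect (@sadj G) x y
    & forall c : seq G, uniq c -> cycle (@sadj G) c -> (size c <= 2)%N].

(* The path is walked from [pfirst] through [prest]; its two orientations have
   the same [path_edges]. One-vertex paths are allowed. *)
Record gpath (G : sgraph) := GPath {
  pfirst : G;
  prest : seq G;
  pwalk : path (@sadj G) pfirst prest;
  psimple : uniq (pfirst :: prest)
}.

Definition path_edges (G : sgraph) (p : gpath G) : {set {set G}} :=
  [set [set q.1; q.2] | q in zip (pfirst p :: prest p) (prest p)].

Lemma path_edges_sub (G : sgraph) (p : gpath G) :
  path_edges p \subset edge_set G.
Proof.
case: p => x s w u; apply/subsetP => f /imsetP[q /= qs ->] {u}.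
apply: imset_f; rewrite inE.
elim: s x w qs => [|y s IH] x //= /andP[xy w].
by rewrite inE => /orP[/eqP -> //|]; apply: IH.
Qed.

Definition path_hypergraph (G : sgraph) (I : finType) (P : I -> gpath G) :
    hypergraph :=
  Hypergraph (fun i => path_edges_sub (P i)).

(* Main.v *)
(* Root the tree and replace each edge e by the set of vertices it separates
   from the root. These sets form a laminar family F, and a path uses e iff
   exactly one of its ends lies in the set of e. It then suffices, when every
   set of F is crossed by at least n >= 6 paths, to find a family C of paths
   such that every set is crossed by at least one path of C and at least n - 5
   paths outside C, and to iterate.
   The family C is obtained by iterated rounding. Start from x = 3/n on every
   path: each set has x-weight at least 3 and (1 - x)-weight at least n - 3.
   Drop a constraint as soon as its bound less 3 is strictly exceeded by
   the paths already rounded in its favour. A remaining tight constraint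
   is crossed by at least 4 fractional paths, and, its bound being an integer,
   two nested tight sets crossed by different fractional paths must have at
   least 2 fractional path ends in their difference. Counting path ends along
   the laminar family shows that there are fewer essentially different tight
   sets than fractional paths, so x can be moved along a line that keeps every
   tight constraint tight until a new constraint becomes tight. *)

Require Import Defs.
From mathcomp Require Import all_boot all_order all_algebra.
From mathcomp Require Import constructive_ereal.
From mathcomp Require Import zify ring lra.

Set Implicit Arguments.
Unset Strict Implicit.
Unset Printing Implicit Defensive.

Import Order.TTheory GRing.Theory Num.Theory.

(** * Weights on laminar families *)

Definition laminar (V : finType) (F : {set {set V}}) : Prop :=
  forall X Y, X \in F -> Y \in F ->
    [|| X \subset Y, Y \subset X | [disjoint X & Y]].

Lemma laminarS (V : finType) (F G : {set {set V}}) :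
  G \subset F -> laminar F -> laminar G.
Proof. by move=> /subsetP GF lamF X Y /GF XF /GF; apply: lamF. Qed.

(* The second summand strengthens the induction: two or more maximal sets leave
   2 extra units, which a set containing them all then absorbs. *)
Lemma laminar_weight (V : finType) (w : V -> nat) (F : {set {set V}}) :
  laminar F ->
  (forall X, X \in F -> 4 <= \sum_(v in X) w v) ->
  (forall X Y, X \in F -> Y \in F -> Y \proper X ->
     2 <= \sum_(v in X :\: Y) w v) ->
  F != set0 ->
  #|F|.+1.*2 + (cover F \notin F).*2 <= \sum_(v in cover F) w v.
Proof.
have [n] := ubnP #|F|; elim: n F => // n IHn F ltFn lamF wF wFD /set0Pn[Z ZF].
case: (arg_maxnP (fun X : {set V} => #|X|) ZF) => X XF Xmax {Z ZF}.
have {}XF : X \in F := XF.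
have IH (G : {set {set V}}) : G \proper F -> G != set0 ->
    #|G|.+1.*2 + (cover G \notin G).*2 <= \sum_(v in cover G) w v.
  move=> ltGF; have /subsetP GF := proper_sub ltGF.
  apply: IHn; first by apply: leq_trans (proper_card ltGF) _; lia.
  - exact: laminarS (proper_sub ltGF) lamF.
  - by move=> Y /GF; apply: wF.
  - by move=> Y Z /GF YF /GF; apply: wFD.
have coverS (G : {set {set V}}) :
    (forall Y, Y \in G -> Y \subset X) -> cover G \subset X.
  by move=> GX; apply/bigcupsP.
have splitw (A B : {set V}) : A \subset B ->
    \sum_(v in B) w v = \sum_(v in A) w v + \sum_(v in B :\: A) w v.
  by move=> /setIidPr AB; rewrite (big_setID A) /= AB.
pose F1 := [set Y in F | Y \subset X].
have [F1E | F1F] := eqVneq F1 F.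
  have subX Y : Y \in F -> Y \subset X by rewrite -F1E inE => /andP[].
  have cF : cover F = X.
    by apply/eqP; rewrite eqEsubset coverS //= (bigcup_max X).
  rewrite cF XF addn0 (cardsD1 X) XF.
  have [F'0 | F'n0] := eqVneq (F :\ X) set0.
    by rewrite F'0 cards0; apply: wF.
  have F'X : cover (F :\ X) \subset X.
    by apply: coverS => Y; rewrite inE => /andP[_ /subX].
  have := IH _ (properD1 XF) F'n0; rewrite (splitw _ _ F'X).
  (* Counting [X] as well costs 2 units: either the extra summand supplies them, or the union of the
     other sets is a member of [F] properly inside [X], and [wFD] does. *)
  case: (boolP (cover (F :\ X) \in F :\ X)) => [|_] /=; last first.
    move=> h; apply: leq_trans (leq_addr _ _); apply: leq_trans h.
    by rewrite -doubleD addn1.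
  rewrite in_setD1 => /andP[cX cF'] /= h.
  have := wFD _ _ XF cF'; rewrite properEneq cX F'X => /(_ isT).
  by move/(leq_add h); apply: leq_trans; rewrite addn0 addn2.
have F1F' : F1 \proper F.
  by rewrite properEneq F1F; apply/subsetP => Y; rewrite inE => /andP[].
have F1n0 : F1 != set0 by apply/set0Pn; exists X; rewrite inE XF /=.
have F2n0 : F :\: F1 != set0 by rewrite setD_eq0; case/andP: F1F'.
have F2F : F :\: F1 \proper F.
  rewrite properEneq subsetDl andbT; apply/eqP => E.
  by have := XF; rewrite -E !inE XF subxx.
have dis : [disjoint cover F1 & cover (F :\: F1)].
  apply: (@disjointWl _ _ X); first by apply: coverS => Y; rewrite inE => /andP[].
  apply: bigcup_disjoint => Y.
  rewrite !inE => /andP[YX YF]; rewrite YF /= in YX.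
  have := lamF _ _ XF YF; rewrite (negPf YX) orbCA orFb.
  case/orP => // XY.
  have := Xmax _ YF; have : X \proper Y by rewrite /proper XY.
  by move/proper_card; lia.
have cF : cover F = cover F1 :|: cover (F :\: F1).
  rewrite /cover -bigcup_setU; apply: eq_bigl => Y.
  by rewrite !inE; case: (_ \in F); case: (_ \subset _).
have cardF : #|F| = #|F1| + #|F :\: F1|.
  by rewrite -(cardsID F1 F) (setIidPr (proper_sub F1F')).
have := IH _ F1F' F1n0; have := IH _ F2F F2n0.
have -> : \sum_(v in cover F) w v =
    \sum_(v in cover F1) w v + \sum_(v in cover (F :\: F1)) w v.
  by rewrite -bigU //; apply: eq_bigl => v; rewrite cF !inE.
rewrite cardF; lia.
Qed.

(** * Linear algebra over ordered fields *)

Lemma exists_kernel_vector (K : fieldType) (I E : finType) (a : E -> I -> K)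
    (J : {set E}) (S : {set I}) :
  (#|J| < #|S|)%N ->
  exists d : I -> K, [/\ exists i, d i != 0%R, forall i, i \notin S -> d i = 0%R
    & forall e, e \in J -> (\sum_(i in S) a e i * d i = 0)%R].
Proof.
move=> ltJS.
pose A := (\matrix_(i < #|S|, j < #|J|) a (enum_val j) (enum_val i))%R.
have : kermx A != 0%R.
  rewrite -mxrank_eq0 mxrank_ker subn_eq0 -ltnNge.
  exact: leq_ltn_trans (rank_leq_col A) ltJS.
case/rowV0Pn => v /sub_kermxP vA; case/rV0Pn => i0 vi0.
have S0 : enum_val i0 \in S := enum_valP i0.
pose d i := (if i \in S then v ord0 (enum_rank_in S0 i) else 0)%R.
have dE (i : 'I_#|S|) : d (enum_val i) = v ord0 i.
  by rewrite /d enum_valP enum_valK_in.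
exists d; split; first by exists (enum_val i0); rewrite dE.
  by move=> i /negPf iS; rewrite /d iS.
move=> e eJ; rewrite big_enum_val /=.
have /matrixP/(_ ord0 (enum_rank_in eJ e)) := vA; rewrite !mxE => vA0.
rewrite -[RHS]vA0; apply: eq_bigr => i _.
by rewrite dE !mxE enum_rankK_in // mulrC.
Qed.

(** Among the coordinates with [v k < 0], the one minimising [u k / - v k] reaches 0 first. *)
Lemma ray_exit (R : realFieldType) (K : finType) (u v : K -> R) :
  (forall k, 0 <= u k)%R -> (exists k, v k < 0)%R ->
  exists t : R, (forall k, 0 <= u k + t * v k)%R /\
    exists k, v k != 0%R /\ (u k + t * v k = 0)%R.
Proof.
move=> u0 [k0 vk0].
case: (@Order.TotalTheory.arg_minP _ _ _ k0 (fun k => v k < 0)%R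
  (fun k => u k / - v k)%R vk0) => k vk kmin.
exists (u k / - v k)%R; split; last first.
  by exists k; split; [rewrite lt_eqF | field; rewrite lt_eqF].
move=> l; have t0 : (0 <= u k / - v k)%R by rewrite divr_ge0 // oppr_ge0 ltW.
have [vl | vl] := ltP (v l) 0%R; last by rewrite addr_ge0 // mulr_ge0.
have := kmin _ vl; rewrite ler_pdivlMr ?oppr_gt0 // mulrN; lra.
Qed.

(** * Iterated rounding *)

Definition crosses (V I : finType) (s t : I -> V) (X : {set V}) : {set I} :=
  [set i | (s i \in X) != (t i \in X)].

Section Rounding.
Variables (V I : finType) (s t : I -> V) (F : {set {set V}}).
Hypothesis lamF : laminar F.
Implicit Types (S : {set I}) (X Y : {set V}) (x d : I -> rat) (b : bool).

Definition ends S X : nat := \sum_(i in S) ((s i \in X) + (t i \in X)).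

Lemma ends_sum S X :
  ends S X = \sum_(v in X) \sum_(i in S) ((s i == v) + (t i == v)).
Proof.
have one u : \sum_(v in X) (u == v) = (u \in X).
  case: (boolP (u \in X)) => uX; last first.
    by rewrite big1 // => v vX; case: eqVneq => // uv; rewrite uv vX in uX.
  rewrite (bigD1 u) //= eqxx big1 ?addn0 // => v /andP[_ /negPf].
  by rewrite eq_sym => ->.
by rewrite exchange_big /=; apply: eq_bigr => i _; rewrite big_split /= !one.
Qed.

(** Paths have two ends, so at most [#|S|.*2] ends lie in [cover J]; [laminar_weight], weighing a
    vertex by the ends at it, gives at least [#|J|.+1.*2]. *)
Lemma ends_laminar S (J : {set {set V}}) :
  J \subset F ->
  (forall X, X \in J -> 4 <= #|S :&: crosses s t X|) ->
  (forall X Y, X \in J -> Y \in J -> Y \proper X -> 2 <= ends S (X :\: Y)) ->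
  0 < #|S| -> #|J| < #|S|.
Proof.
move=> JF J4 JD S0; have [->|J0] := eqVneq J set0; first by rewrite cards0.
have ub : ends S (cover J) <= #|S|.*2.
  rewrite /ends -mul2n mulnC -sum_nat_const; apply: leq_sum => i _.
  by case: (_ \in _); case: (_ \in _).
suff lb : #|J|.+1.*2 <= ends S (cover J).
  by move: (leq_trans lb ub); rewrite leq_double.
rewrite ends_sum; apply: leq_trans (leq_addr (cover J \notin J).*2 _) _.
apply: laminar_weight J0.
- exact: laminarS JF lamF.
- move=> X /J4 h; rewrite -ends_sum; apply: leq_trans h _.
  rewrite /ends -sum1_card [leqRHS](big_setID (crosses s t X)) /=.
  apply: (leq_trans _ (leq_addr _ _)); apply: leq_sum => i; rewrite !inE.
  by case: (_ \in X); case: (_ \in X); rewrite ?andbF.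
- by move=> X Y XJ YJ /(JD _ _ XJ YJ); rewrite ends_sum.
Qed.

Lemma ends_le1 S X :
  ends S X <= 1 ->
  (forall i, i \in S -> s i \notin X /\ t i \notin X) \/
  (exists2 i, i \in S & (s i \in X) != (t i \in X) /\
     forall j, j \in S -> j != i -> s j \notin X /\ t j \notin X).
Proof.
rewrite /ends => le1.
have [/forallP h | /forallPn[i]] :=
  boolP [forall i, (i \in S) ==> (s i \notin X) && (t i \notin X)].
  by left=> i iS; have := h i; rewrite iS => /andP.
rewrite negb_imply => /andP[iS ni]; right; exists i => //.
move: le1; rewrite (bigD1 i) //= => le1; split.
  by move: ni le1; case: (_ \in X); case: (_ \in X).
move=> j jS ji; move: le1; rewrite (bigD1 j) ?jS //=.
move: ni; case: (s i \in X); case: (t i \in X) => //.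
all: by case: (s j \in X); case: (t j \in X).
Qed.

Local Open Scope ring_scope.

(* The lower bounds on x and on 1 - x are treated uniformly: b = true stands for
   x and b = false for 1 - x. *)
Definition signed b x i : rat := if b then x i else 1 - x i.

Variable demand : bool -> nat.

Definition ones b x X : {set I} := [set i in crosses s t X | signed b x i == 1].

Definition safe b x X : bool := (demand b < #|ones b x X| + 3)%N.

(* A constraint that no longer has to be enforced gets residual 0, so that
   [slack] never regains an index and can serve as a termination measure. *)
Definition residual x (k : bool * (I + {set V})) : rat :=
  match k.2 with
  | inl i => signed k.1 x i
  | inr X => if (X \in F) && ~~ safe k.1 x X
             then \sum_(i in crosses s t X) signed k.1 x i - (demand k.1)%:R
             else 0
  end.

Definition slack x : {set bool * (I + {set V})} :=
  [set k | residual x k != 0].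

Definition frac x : {set I} := [set i | (x i != 0) && (x i != 1)].

Definition tight x : {set {set V}} :=
  [set X in F | [exists b, ~~ safe b x X && (residual x (b, inr X) == 0)]].

Section Step.
Variable x : I -> rat.
Hypothesis res0 : forall k, 0 <= residual x k.

Lemma signed_frac b i : i \in frac x -> 0 < signed b x i < 1.
Proof.
rewrite inE => /andP[x0 x1].
have := res0 (true, inl i); have := res0 (false, inl i); rewrite /residual /signed /=.
by case: b; move: x0 x1; rewrite !neq_lt; lra.
Qed.

Lemma signed_nfrac b i : i \notin frac x -> signed b x i = (signed b x i == 1)%:R.
Proof.
rewrite inE negb_and !negbK /signed => /orP[] /eqP ->; case: b.
all: by rewrite ?subrr ?subr0 ?eqxx.
Qed.

Lemma sum_signed b X :
  \sum_(i in crosses s t X) signed b x i =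
  #|ones b x X|%:R + \sum_(i in frac x :&: crosses s t X) signed b x i.
Proof.
rewrite (big_setID (frac x)) /= setIC addrC; congr (_ + _).
rewrite -sum1_card natr_sum [RHS](eq_bigl (fun i =>
  (i \in crosses s t X :\: frac x) && (signed b x i == 1))).
  rewrite big_mkcondr /=; apply: eq_bigr => i; rewrite inE => /andP[/signed_nfrac -> _].
  by case: eqP.
move=> i; rewrite !inE; case: (signed b x i =P 1) => [E|_]; rewrite ?andbF ?andbT //.
have : i \notin frac x by apply/negP => /(signed_frac b); rewrite E ltxx andbF.
by rewrite inE => ->.
Qed.

(** At a tight constraint the fractional paths contribute [demand b] minus the number of ones, an
    integer; for [b = false], the sum of [x] is a number of paths minus that integer. *)
Lemma tight_int X :
  X \in tight x -> \sum_(i in frac x :&: crosses s t X) x i \is a Num.int.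
Proof.
rewrite inE => /andP[XF /existsP[b /andP[ns]]].
rewrite /residual /= XF ns sum_signed => /eqP E.
have bint : \sum_(i in frac x :&: crosses s t X) signed b x i \is a Num.int.
  rewrite (_ : \sum_(i in _) _ = (demand b)%:R - #|ones b x X|%:R); last by lra.
  by rewrite rpredB ?natr_int.
case: b bint {ns E} => //; rewrite /signed sumrB sumr_const => h.
by rewrite -[X in X \is a _](subKr #|frac x :&: crosses s t X|%:R) rpredB ?natr_int.
Qed.

(** As the constraint is not safe, the fractional paths must supply at least 3 units, and each
    supplies less than 1. *)
Lemma tight_card X : X \in tight x -> (4 <= #|frac x :&: crosses s t X|)%N.
Proof.
rewrite inE => /andP[XF /existsP[b /andP[ns]]].
rewrite /residual /= XF ns sum_signed => /eqP E; rewrite leqNgt; apply: contra ns => le3.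
rewrite /safe -(ltr_nat rat) natrD.
suff : \sum_(i in frac x :&: crosses s t X) signed b x i < 3 by lra.
have [->|/set0Pn[i iS]] := eqVneq (frac x :&: crosses s t X) set0.
  by rewrite big_set0.
apply: (@lt_le_trans _ _ #|frac x :&: crosses s t X|%:R); last by rewrite ler_nat.
rewrite -sumr_const; apply: ltr_sum => //.
  by apply/hasP; exists i => //; rewrite mem_index_enum.
by move=> j; rewrite inE => /andP[/(signed_frac b)/andP[]].
Qed.

Lemma tight_nested X Y : X \in tight x -> Y \in tight x -> Y \subset X ->
  frac x :&: crosses s t X != frac x :&: crosses s t Y ->
  (2 <= ends (frac x) (X :\: Y))%N.
Proof.
move=> tX tY /subsetP YX ne; rewrite leqNgt ltnS; apply/negP => /ends_le1.
have outside i : s i \notin X :\: Y -> t i \notin X :\: Y ->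
    (i \in crosses s t X) = (i \in crosses s t Y).
  rewrite !inE; have := YX (s i); have := YX (t i).
  by do 4![case: (_ \in _)] => //= h1 h2; do ?[by have := h1 isT | by have := h2 isT].
case=> [h | [i iS [ci h]]].
  case/eqP: ne; apply/setP => i; rewrite !in_setI.
  case: (boolP (i \in frac x)) => //= iS.
  by apply: outside; case: (h i iS).
(* Only the path i distinguishes X from Y, so x i would be an integer. *)
have xi : x i \is a Num.int.
  have sumi (Z : {set V}) : \sum_(j in frac x :&: crosses s t Z) x j =
    (i \in crosses s t Z)%:R * x i + \sum_(j in (frac x :&: crosses s t Z) :\ i) x j.
    case: (boolP (i \in crosses s t Z)) => iZ.
      by rewrite (big_setD1 i) ?in_setI ?iS ?iZ //= mul1r.
    rewrite mul0r add0r; apply: eq_bigl => j; rewrite in_setD1 !in_setI.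
    by case: eqVneq => // ->; rewrite (negPf iZ) andbF.
  have same : (frac x :&: crosses s t X) :\ i = (frac x :&: crosses s t Y) :\ i.
    apply/setP => j; rewrite !in_setD1 !in_setI; case: eqVneq => //= ji.
    case: (boolP (j \in frac x)) => //= jS; by apply: outside; case: (h j jS ji).
  have xor : (i \in crosses s t X) != (i \in crosses s t Y).
    move: ci; rewrite !inE; have := YX (s i); have := YX (t i).
    by do 4![case: (_ \in _)] => //= h1 h2; do ?[by have := h1 isT | by have := h2 isT].
  have := rpredB (tight_int tX) (tight_int tY); rewrite !sumi same.
  case: (i \in crosses s t X) (i \in crosses s t Y) xor => -[] //= _.
    by rewrite mul1r mul0r add0r addrK.
  by rewrite mul1r mul0r add0r opprD addrCA subrr addr0 rpredN.
have := signed_frac true iS; rewrite /signed => /andP[x0 x1].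
case/intrP: xi x0 x1 => m ->; rewrite ltr0z ltrz1; lia.
Qed.

(** Tight sets crossed by the same fractional paths impose the same equation on [d], so one
    representative per class suffices. Representatives satisfy the hypotheses of [ends_laminar],
    which leaves fewer equations than unknowns. *)
Lemma exists_direction : frac x != set0 ->
  exists d, [/\ exists i, d i != 0, forall i, i \notin frac x -> d i = 0
    & forall X, X \in tight x -> \sum_(i in crosses s t X) d i = 0].
Proof.
move=> fx0; pose tr X := frac x :&: crosses s t X.
pose rep X := odflt X [pick Y in tight x | tr Y == tr X].
have repP X : X \in tight x -> rep X \in tight x /\ tr (rep X) = tr X.
  move=> tX; rewrite /rep; case: pickP => [Y /andP[tY /eqP] /=|/(_ X)]; first by split.
  by rewrite tX eqxx.
have rep_eq X Y :
    X \in tight x -> Y \in tight x -> tr X = tr Y -> rep X = rep Y.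
  move=> tX tY E; rewrite /rep (eq_pick (Q := [pred Z in tight x | tr Z == tr Y])).
    by case: pickP => // /(_ Y); rewrite /= tY eqxx.
  by move=> Z; rewrite /= E.
pose J := rep @: tight x.
have Jt X : X \in J -> X \in tight x by case/imsetP => Y tY ->; case: (repP _ tY).
have Jinj X Y : X \in J -> Y \in J -> tr X = tr Y -> X = Y.
  case/imsetP => X' tX -> /imsetP[Y' tY ->].
  by rewrite (repP _ tX).2 (repP _ tY).2; apply: rep_eq.
have ltJ : (#|J| < #|frac x|)%N.
  apply: ends_laminar; last by rewrite card_gt0.
  - by apply/subsetP => X /Jt; rewrite inE => /andP[].
  - by move=> X /Jt/tight_card.
  move=> X Y XJ YJ YX; apply: tight_nested (Jt _ XJ) (Jt _ YJ) (proper_sub YX) _.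
  by apply: contraTneq YX => /(Jinj _ _ XJ YJ) ->; rewrite properxx.
have [d [d0 dS dJ]] := exists_kernel_vector (fun X i => (i \in crosses s t X)%:R : rat) ltJ.
exists d; split=> // X tX.
have sumtr Z : \sum_(i in crosses s t Z) d i = \sum_(i in tr Z) d i.
  rewrite (big_setID (frac x)) /= [X in _ + X]big1 ?addr0 1?setIC //.
  by move=> i; rewrite inE => /andP[/dS].
rewrite sumtr -(repP _ tX).2; apply: etrans (dJ (rep X) (imset_f _ tX)).
rewrite big_mkcond [RHS]big_mkcond; apply: eq_bigr => i _; rewrite in_setI.
by case: (i \in frac x); case: (i \in crosses _ _ _); rewrite ?mul1r ?mul0r.
Qed.

Lemma rounding_step : frac x != set0 ->
  exists y, (forall k, 0 <= residual y k) /\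
    (#|slack y| < #|slack x|)%N.
Proof.
move=> fx0; have [d [[i0 di0] dS dtight]] := exists_direction fx0.
pose sd b i := if b then d i else - d i.
(* The rate of change of [residual] along [d], with safety frozen as it is at [x]. *)
pose v (k : bool * (I + {set V})) := match k.2 with
  | inl i => sd k.1 i
  | inr X => if (X \in F) && ~~ safe k.1 x X
             then \sum_(i in crosses s t X) sd k.1 i else 0 end.
have [k vk]: exists k, v k < 0.
  by have := di0; rewrite neq_lt => /orP[] h;
    [exists (true, inl i0) | exists (false, inl i0)]; rewrite /v /= ?oppr_lt0.
have [c [ge0 [l [vl0 l0]]]] := ray_exit res0 (ex_intro _ k vk).
pose y i := x i + c * d i.
have sy b i : signed b y i = signed b x i + c * sd b i.
  by rewrite /signed /y /sd; case: b; ring.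
(* A path counted in [ones] is not fractional, so [d] does not move it. *)
have safe_mono b X : safe b x X -> safe b y X.
  rewrite /safe => h; apply: leq_trans h _; rewrite leq_add2r subset_leq_card //.
  apply/subsetP => i; rewrite !inE sy => /andP[-> /eqP E] /=.
  rewrite E /sd dS ?oppr0 ?if_same ?mulr0 ?addr0 //.
  by apply/negP => /(signed_frac b); rewrite E ltxx andbF.
have ry m : residual y m = 0 \/ residual y m = residual x m + c * v m.
  case: m => b [i|X]; rewrite /residual /v /=; first by right.
  case: (boolP (X \in F)) => XF /=; last by left.
  case: (boolP (safe b y X)) => sX /=; first by left.
  right; rewrite (contra (@safe_mono b X)) //=.
  by under eq_bigr => i _ do rewrite sy; rewrite big_split /= -mulr_sumr; ring.
have vx0 m : residual x m = 0 -> v m = 0.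
  case: m => b [i|X]; rewrite /residual /v /=.
    move=> E; rewrite /sd dS ?oppr0 ?if_same //.
    by apply/negP => /(signed_frac b); rewrite E ltxx.
  case: ifP => // /andP[XF nsafe] E.
  have tX : X \in tight x.
    by rewrite inE XF; apply/existsP; exists b; rewrite nsafe /residual /= XF nsafe E /=.
  by have := dtight _ tX; rewrite /sd; case: b {E nsafe} => // h; rewrite sumrN h oppr0.
exists y; split=> [m|]; first by case: (ry m) => ->.
apply: proper_card; apply/properP; split.
  apply/subsetP => m; rewrite !inE; apply: contraNneq => x0.
  by case: (ry m) => ->; rewrite ?x0 ?vx0 // mulr0 addr0.
(* [l] was slack at [x], as [v] vanishes wherever the residual does, and is not slack at [y]. *)
exists l; rewrite inE; first by apply: contraNneq vl0 => /vx0 ->.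
by rewrite negbK; case: (ry l) => ->; rewrite ?l0.
Qed.

End Step.

Lemma rounding x : (forall k, 0 <= residual x k) ->
  exists C : {set I}, forall X, X \in F ->
    (demand true < #|crosses s t X :&: C| + 3)%N /\
    (demand false < #|crosses s t X :\: C| + 3)%N.
Proof.
have [n] := ubnP #|slack x|.
elim: n x => // n IHn x len res0.
have [fx|/(rounding_step res0)[y [yres lt]]] := eqVneq (frac x) set0; last first.
  by apply: (IHn y) => //; apply: leq_trans lt _.
have x01 i : x i = 0 \/ x i = 1.
  have : i \notin frac x by rewrite fx inE.
  by rewrite inE negb_and !negbK => /orP[] /eqP; [left|right].
(* Without fractional paths, a nonnegative residual says that the ones alone meet the demand, which
   makes the constraint safe. *)
have allsafe b X : X \in F -> safe b x X.
  move=> XF; apply: contraT => ns; have := res0 (b, inr X).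
  rewrite /residual /= XF ns (sum_signed res0) fx set0I big_set0 addr0 subr_ge0 ler_nat.
  by move: ns; rewrite /safe; lia.
exists [set i | x i == 1] => X XF; split.
  rewrite (_ : _ :&: _ = ones true x X); first exact: allsafe.
  by apply/setP => i; rewrite !inE.
rewrite (_ : _ :\: _ = ones false x X); first exact: allsafe.
by apply/setP => i; rewrite !inE /signed andbC; case: (x01 i) => ->.
Qed.

Lemma exists_cover n : (6 <= n)%N ->
  demand true = 3 -> demand false = (n - 3)%N ->
  (forall X, X \in F -> (n <= #|crosses s t X|)%N) ->
  exists C : {set I}, forall X, X \in F ->
    (0 < #|crosses s t X :&: C|)%N /\ (n - 5 <= #|crosses s t X :\: C|)%N.
Proof.
move=> n6 dt df deg.
have n0 : 0 < n%:R :> rat by rewrite ltr0n; lia.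
have [|C CP] := @rounding (fun=> 3 / n%:R); last first.
  (* Safety reads [3 < p + 3] and [n - 3 < q + 3], that is [0 < p] and [n - 5 <= q]. *)
  by exists C => X /CP[]; rewrite dt df; lia.
have x1 : 3 / n%:R <= 1 :> rat by rewrite ler_pdivrMr // mul1r ler_nat; lia.
case=> b [i|X]; rewrite /residual /= .
  by rewrite /signed; case: b; rewrite ?subr_ge0 // divr_ge0 // ltW.
case: ifP => // /andP[XF _]; rewrite sumr_const -[X in X - _]mulr_natr subr_ge0.
have dX : n%:R <= #|crosses s t X|%:R :> rat by rewrite ler_nat deg.
have x0 : 0 <= 3 / n%:R :> rat by rewrite divr_ge0 // ltW.
have E3 : 3 / n%:R * n%:R = 3 :> rat by rewrite divfK // gt_eqF.
rewrite /signed; case: b; rewrite ?dt ?df.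
  by have := ler_wpM2l x0 dX; rewrite E3.
have -> : (n - 3)%:R = (1 - 3 / n%:R) * n%:R :> rat.
  by rewrite mulrBl E3 mul1r natrB //; lia.
by rewrite ler_wpM2l // subr_ge0.
Qed.

End Rounding.

(** * Extracting covers one after another *)

Lemma cover_colouring (V I : finType) (s t : I -> V) (F : {set {set V}}) k :
  laminar F -> (forall X, X \in F -> 5 * k < #|crosses s t X|) ->
  exists c : I -> nat, forall j X, j <= k -> X \in F ->
    exists2 i, c i = j & i \in crosses s t X.
Proof.
move=> lamF; elim: k t => [|k IHk] t deg.
  exists (fun=> 0) => j X; rewrite leqn0 => /eqP -> /deg.
  rewrite muln0 => /card_gt0P[i iX].
  by exists i.
(* Each cover lowers the guaranteed number of crossings by 5, from [5 * k.+1 + 1] to [5 * k + 1], as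
   the induction hypothesis requires. *)
have n6 : 6 <= (5 * k.+1).+1 by lia.
have [C CP] := @exists_cover _ _ s t F lamF
  (fun b => if b then 3 else (5 * k.+1).+1 - 3) _ n6 erefl erefl deg.
(* Paths of C are made trivial, so that they cross nothing any more. *)
pose t' i := if i \in C then s i else t i.
have crossD X : crosses s t' X = crosses s t X :\: C.
  by apply/setP => i; rewrite !inE /t'; case: (i \in C); rewrite ?eqxx.
have [X XF|c cP] := IHk t'.
  by rewrite crossD; apply: leq_trans (CP X XF).2; lia.
exists (fun i => if i \in C then k.+1 else c i) => j X jk XF.
have [->|jk1] := eqVneq j k.+1.
  have /card_gt0P[i] := (CP X XF).1; rewrite in_setI => /andP[iX iC].
  by exists i => //; rewrite iC.
have [|i ci] := cP j X _ XF; first by lia.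
by rewrite crossD in_setD => /andP[/negPf iC iX]; exists i; rewrite ?iC.
Qed.

(** * Far sides of the edges of a rooted tree *)

Section Tree.
Variables (T : sgraph) (treeT : is_tree T) (r : T).

Definition del_edge (e : {set T}) : rel T :=
  [rel x y | sadj x y && ([set x; y] != e)].

Definition far_side (e : {set T}) : {set T} :=
  [set v | ~~ connect (del_edge e) r v].

Lemma connect_del_edge_sym e : connect_sym (del_edge e).
Proof. by apply: sym_connect_sym => x y; rewrite /del_edge /= (sadj_sym x) setUC. Qed.

Lemma far_side_connect e x y :
  connect (del_edge e) x y -> (x \in far_side e) = (y \in far_side e).
Proof.
move=> xy; rewrite !inE; congr (~~ _).
exact: same_connect_r (@connect_del_edge_sym e) _ _ xy _.
Qed.

(** A simple path from [a] to [b] avoiding the edge would close up with it into a cycle on at least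
    three vertices. *)
Lemma tree_bridge a b :
  sadj a b -> ~~ connect (del_edge [set a; b]) a b.
Proof.
move=> ab; case: treeT => _ _ acyc; apply/negP => /connectP[p0 pth].
case/shortenP: pth => p pth up _ bE.
have padj : path (@sadj T) a p by apply: sub_path pth => x y /andP[].
have /acyc : uniq (a :: p) by [].
rewrite /= rcons_path padj -bE sadj_sym ab => /(_ isT).
case: p => [|c [|//]] in pth up padj bE * => _.
  by move: ab; rewrite bE /= sadj_irr.
  by move: pth; rewrite bE /del_edge /= eqxx andbF.
Qed.

(** On a walk from [a] to [v], each passage through the deleted edge lands on [a] or [b], so every
    vertex met is reachable from one of them. *)
Lemma del_edge_connect a b v :
  connect (del_edge [set a; b]) a v || connect (del_edge [set a; b]) b v.
Proof.
case: treeT => _ /(_ a v)/connectP[p pth ->] _.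
set e := [set a; b].
set Q := fun v => connect (del_edge e) a v || connect (del_edge e) b v.
have : Q a by rewrite /Q connect0.
rewrite -/(Q _); elim: p (a) pth => //= y p IHp x /andP[xy pth] Qx.
apply: IHp pth _; have [xye | nxy] := eqVneq [set x; y] e.
  have : y \in e by rewrite -xye set22.
  by rewrite !inE => /orP[] /eqP ->; rewrite /Q connect0 ?orbT.
have dxy : connect (del_edge e) x y by apply: connect1; rewrite /del_edge /= xy.
by case/orP: Qx => /connect_trans/(_ dxy); rewrite /Q => ->; rewrite ?orbT.
Qed.

Lemma far_side_edge a b :
  sadj a b -> (a \in far_side [set a; b]) != (b \in far_side [set a; b]).
Proof.
move=> ab; have := tree_bridge ab; have := del_edge_connect a b r.
rewrite !inE !(connect_del_edge_sym _ r); set e := [set a; b].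
case: (boolP (connect _ a r)) => [ar|]; case: (boolP (connect _ b r)) => // br _.
by rewrite (connect_trans ar) // connect_del_edge_sym.
Qed.

(** The side changes exactly when [e] is traversed, and a simple path traverses [e] at most once. *)
Lemma far_side_path e x p :
  e \in edge_set T -> path (@sadj T) x p -> uniq (x :: p) ->
  (e \in [set [set q.1; q.2] | q in zip (x :: p) p]) =
  ((x \in far_side e) != (last x p \in far_side e)).
Proof.
have memS y q : e \in [set [set z.1; z.2] | z in zip (y :: q) q] ->
    e \subset y :: q.
  case/imsetP => -[c d] /= cd ->.
  apply/subsetP => z; rewrite !inE; elim: q y cd => //= u q IHq y.
  rewrite !inE xpair_eqE => /orP[/andP[/eqP -> /eqP ->]|/IHq IH /IH -> //];
    last by rewrite orbT.
  by case/orP => ->; rewrite ?orbT.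
have consE y u q : e \in [set [set z.1; z.2] | z in zip (y :: u :: q) (u :: q)] =
    ([set y; u] == e) || (e \in [set [set z.1; z.2] | z in zip (u :: q) q]).
  apply/imsetP/orP => /= [[z]|[/eqP <-|/imsetP[z zq ->]]].
  - rewrite inE => /orP[/eqP -> ->|zq ->]; first by left.
    by right; apply: imset_f.
  - by exists (y, u) => //; rewrite inE eqxx.
  - by exists z => //; rewrite inE zq orbT.
move=> eE; elim: p x => [|y p IHp] x /= .
  by move=> _ _; rewrite eqxx; apply/negP => /imsetP[].
case/andP => xy pth /andP[xyp /= /[dup] up' /andP[yp up]].
rewrite consE; have [xye | nxy] /= := eqVneq.
  have := far_side_edge xy; rewrite xye.
  have : e \notin [set [set z.1; z.2] | z in zip (y :: p) p].
    by apply: contra xyp => /memS/subsetP/(_ x); rewrite -xye set21 => ->.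
  by rewrite (IHp y) // negbK => /eqP <-.
rewrite (IHp y) //; congr (_ != _); apply/esym/far_side_connect/connect1.
by rewrite /del_edge /= xy.
Qed.

Lemma path_edges_crosses (I : finType) (P : I -> gpath T) i e :
  e \in edge_set T ->
  (e \in path_edges (P i)) =
  (i \in crosses (fun i => pfirst (P i))
           (fun i => last (pfirst (P i)) (prest (P i))) (far_side e)).
Proof.
move=> eE; rewrite inE; exact: far_side_path (pwalk _) (psimple _).
Qed.

(** A walk from [z] avoiding [e] never meets [c], hence never traverses [f]. *)
Lemma connect_del_edge_avoid e (f : {set T}) z c v :
  c \in f -> ~~ connect (del_edge e) z c ->
  connect (del_edge e) z v -> connect (del_edge f) z v.
Proof.
move=> cf zc /connectP[p]; elim/last_ind: p v => [|p y IHp] v.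
  by move=> _ ->.
rewrite last_rcons rcons_path => /andP[pth ly] ->.
have zl : connect (del_edge e) z (last z p) by apply/connectP; exists p.
have zy := connect_trans zl (connect1 ly).
apply: connect_trans (IHp _ pth erefl) (connect1 _).
case/andP: ly => ly _; rewrite /del_edge /= ly; apply/eqP => E; move: cf zc.
by rewrite -E !inE => /orP[] /eqP ->; rewrite ?zl ?zy.
Qed.

(** The side of [e] missing the end [c] of [f] stays connected when [f] is deleted. If it is the
    side of the root, the far side of [f] lies within that of [e]; otherwise the far side of [e]
    lies wholly on one side of [f]. *)
Lemma far_side_laminar : laminar [set far_side e | e in edge_set T].
Proof.
move=> _ _ /imsetP[e eE ->] /imsetP[f fE ->].
have [->|nef] := eqVneq e f; first by rewrite subxx.
case/imsetP: fE => -[c d] /=; rewrite inE /= => cd fcd.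
have cf : c \in f by rewrite fcd set21.
case: (boolP (c \in far_side e)) => ce.
  apply/or3P/Or32/subsetP => v; rewrite inE; apply: contraR.
  rewrite inE negbK; apply: (connect_del_edge_avoid cf).
  by move: ce; rewrite inE.
have [b bE]: exists b, far_side e = [set v | connect (del_edge e) b v].
  case/imsetP: eE => -[a b] /=; rewrite inE /= => ab eab.
  have sub x y : e = [set x; y] -> x \notin far_side e -> y \in far_side e ->
      far_side e = [set v | connect (del_edge e) y v].
    move=> exy xr yr; apply/setP => v; apply/idP/idP; last first.
      by rewrite inE => /far_side_connect <-.
    rewrite !inE => rv; have := del_edge_connect x y v; rewrite -exy.
    by case/orP => // /far_side_connect; rewrite (negPf xr) inE (negPf rv).
  have := far_side_edge ab; rewrite -eab.
  case: (boolP (a \in _)) => ar; case: (boolP (b \in _)) => // br _.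
    by exists a; apply: (sub b) => //; rewrite setUC.
  by exists b; apply: (sub a).
have same v : v \in far_side e -> (b \in far_side f) = (v \in far_side f).
  rewrite bE inE => bv; apply: far_side_connect.
  apply: connect_del_edge_avoid cf _ bv.
  by move: ce; rewrite bE inE.
case: (boolP (b \in far_side f)) => bf; apply/or3P.
  by apply: Or31; apply/subsetP => v /same E; rewrite -E.
apply: Or33; rewrite disjoint_subset; apply/subsetP => v /same E.
by rewrite [v \in _]inE -E.
Qed.

End Tree.

(** * From colourings to cover decompositions *)

Theorem theorem4 (T : sgraph) (delta : nat) (I : finType) (P : I -> gpath T)
    (treeT : is_tree T)
    (coverage : forall f : {set T}, f \in edge_set T ->
       (delta <= #|[set i | f \in path_edges (P i)]|)%N) :
  ((1 + ((delta%:Z - 1) %/ 5)%Z)%R%:E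
     <= cover_decomposition_number (path_hypergraph P))%E
  /\ ((0 < delta)%N ->
      cover_decomposable (path_hypergraph P) (1 + (delta - 1) %/ 5)%N).
Proof.
have dec : (0 < delta)%N ->
    cover_decomposable (path_hypergraph P) (1 + (delta - 1) %/ 5)%N.
  move=> delta0; have [/card_gt0P[r _] _ _] := treeT.
  have [X|c cP] := cover_colouring (s := fun i => pfirst (P i))
      (t := fun i => last (pfirst (P i)) (prest (P i)))
      (k := ((delta - 1) %/ 5)%N) (far_side_laminar treeT (r := r)).
    case/imsetP => e eE ->; apply: leq_trans (leq_trans (coverage e eE) _).
      by have := leq_divM (delta - 1) 5; lia.
    apply/subset_leq_card/subsetP => i; rewrite inE.
    by rewrite (path_edges_crosses treeT r P i eE).
  (* [cover_colouring] does not bound [c i]; [inord] sends colours out of range to 0, which only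
     enlarges that part. *)
  apply/existsP; exists [ffun i => inord (c i)].
  apply/forallP => j; rewrite /set_cover eqEsubset; apply/andP; split.
    by apply/bigcupsP => i _; exact: path_edges_sub.
  apply/subsetP => e eE.
  have [||i ci iX] := cP j (far_side r e); [by rewrite -ltnS | exact: imset_f |].
  apply/bigcupP; exists i; first by rewrite inE ffunE ci inord_val.
  by rewrite /= (path_edges_crosses treeT r P i eE).
split=> //; rewrite /cover_decomposition_number.
case: ifPn => [_|V0]; first exact: leey.
(* For [delta = 0], integer division rounds [-1 / 5] down to [-1], and the bound is 0. *)
rewrite lee_fin; case: delta dec {coverage} => [|d] dec; first by [].
have kdec := dec isT; have kI := cover_decomposable_leq V0 kdec.
rewrite -[d.+1]addn1 PoszD addrK divz_nat -PoszD lez_nat.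
move: kdec kI; rewrite subn1 /= => kdec kI.
have kI' : (1 + d %/ 5 < #|I|.+1)%N by [].
exact: (@leq_bigmax_cond _ (fun k : 'I__ => cover_decomposable _ k)
  (@nat_of_ord _) (Ordinal kI')).
Qed.
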